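(* Consider the differential game of protecting the plane $z=0$ in 3-D space between one evader $E$ and three pursuers $P_1,P_2,P_3$ of equal (unit) speed, with terminal payoff $z_E(t_f)$ minimized by $E$ and maximized by the pursuers, and assume that $\mathbf{x}\in\mathcal{R}_p$, where $\mathcal{R}_p=\{\mathbf{x}\ |\ B(\mathbf{x})>0\}$ is the pursuers' winning region (the game and the Barrier function $B$ are defined in the context). With $R_E=\sqrt{x_E^2+y_E^2+z_E^2}$ and $R_i=\sqrt{x_i^2+y_i^2+z_i^2}$, $i=1,2,3$, the Value function is $C^1$, it is the solution of the Hamilton-Jacobi-Isaacs (HJI) partial differential equation, and it is given by $$V(\mathbf{x})=\frac{\nu_E R_E^2-\nu_1R_1^2-\nu_2R_2^2-\nu_3R_3^2}{2\Lambda},$$ where \begin{align*} \nu_E&=x_1(y_2-y_3)+x_2(y_3-y_1)+x_3(y_1-y_2),\\ \nu_1&=x_2(y_3-y_E)+x_3(y_E-y_2)+x_E(y_2-y_3),\\ \nu_2&=x_3(y_1-y_E)+x_1(y_E-y_3)+x_E(y_3-y_1),\\ \nu_3&=x_1(y_2-y_E)+x_2(y_E-y_1)+x_E(y_1-y_2), \end{align*} and \begin{align*} \Lambda&=x_E(y_3z_1-y_1z_3)+y_E(x_1z_3-x_3z_1)+z_E(x_3y_1-x_1y_3)\\ &\quad-x_2[y_3(z_1-z_E)+y_1(z_E-z_3)+y_E(z_3-z_1)]\\ &\quad-y_2[x_3(z_E-z_1)+x_1(z_3-z_E)+x_E(z_1-z_3)]\\ &\quad-z_2[x_3(y_1-y_E)+x_1(y_E-y_3)+x_E(y_3-y_1)].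 \end{align*} The optimal state-feedback strategy of the evader is $$\mathbf{u}_E^*=\frac{1}{d_E}\,[x^*(\mathbf{x})-x_E,\ y^*(\mathbf{x})-y_E,\ z^*(\mathbf{x})-z_E],\qquad d_E=\sqrt{(x^*-x_E)^2+(y^*-y_E)^2+(z^*-z_E)^2},$$ and the optimal state-feedback strategies of the pursuers are $$\mathbf{u}_i^*=\frac{1}{d_i}\,[x^*(\mathbf{x})-x_i,\ y^*(\mathbf{x})-y_i,\ z^*(\mathbf{x})-z_i],\qquad d_i=\sqrt{(x^*-x_i)^2+(y^*-y_i)^2+(z^*-z_i)^2},\quad i=1,2,3.$$ The coordinates of the optimal interception point are $$x^*(\mathbf{x})=\frac{\mu_ER_E^2-\mu_1R_1^2-\mu_2R_2^2-\mu_3R_3^2}{2\Lambda},\qquad y^*(\mathbf{x})=\frac{\eta_ER_E^2-\eta_1R_1^2-\eta_2R_2^2-\eta_3R_3^2}{2\Lambda},\qquad z^*(\mathbf{x})=V(\mathbf{x}),$$ where \begin{align*} \mu_E&=y_1(z_2-z_3)+y_2(z_3-z_1)+y_3(z_1-z_2),\\ \mu_1&=y_2(z_3-z_E)+y_3(z_E-z_2)+y_E(z_2-z_3),\\ \mu_2&=y_3(z_1-z_E)+y_1(z_E-z_3)+y_E(z_3-z_1),\\ \mu_3&=y_1(z_2-z_E)+y_2(z_E-z_1)+y_E(z_1-z_2), \end{align*} and \begin{align*} \eta_E&=x_1(z_3-z_2)+x_2(z_1-z_3)+x_3(z_2-z_1),\\ \eta_1&=x_2(z_E-z_3)+x_3(z_2-z_E)+x_E(z_3-z_2),\\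 \eta_2&=x_3(z_E-z_1)+x_1(z_3-z_E)+x_E(z_1-z_3),\\ \eta_3&=x_1(z_E-z_2)+x_2(z_1-z_E)+x_E(z_2-z_1). \end{align*}
   Context: The game. The evader $E$ has position $\mathbf{x}_E=(x_E,y_E,z_E)$ and the pursuers $P_i$ have positions $\mathbf{x}_i=(x_i,y_i,z_i)$, $i=1,2,3$; the state is $\mathbf{x}=(\mathbf{x}_E,\mathbf{x}_1,\mathbf{x}_2,\mathbf{x}_3)\in\mathbb{R}^{12}$. The dynamics $\dot{\mathbf{x}}=\mathbf{f}(\mathbf{x},\mathbf{u}_E,\mathbf{u}_i)$ are $\dot{\mathbf{x}}_E=\mathbf{u}_E$, $\dot{\mathbf{x}}_i=\mathbf{u}_i$, with controls in $\mathcal{U}=\{\mathbf{u}\in\mathbb{R}^3:\|\mathbf{u}\|_2=1\}$. The goal plane is $\Omega_G=\{z=0\}$, the game set is $\Omega=\{(x,y,z):z>0\}$, and initially $z_E>0$. The game terminates at the time $t_f$ at which either $\mathbf{x}_i=\mathbf{x}_E$ for some $i$ (capture; the pursuers win) or $z_E=0$ (the evader reaches the goal plane and wins). Payoff and Value. For states in $\mathcal{R}_p$ the payoff is $J=z_E(t_f)$, where $t_f$ is the time of capture, and the Value is $V(\mathbf{x}_0)=\min_{\mathbf{u}_E(\cdot)}\max_{\mathbf{u}_i(\cdot)}J(\mathbf{u}_E(\cdot),\mathbf{u}_i(\cdot);\mathbf{x}_0)$ over state-feedback strategies (functions of the current state only) of $E$ and of the cooperating team $P_1,P_2,P_3$.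 A non-terminating play is regarded by $E$ as worse, and by the pursuers as better, than every terminating outcome. HJI equation. In general it reads $-\frac{\partial V}{\partial t}=\frac{\partial V}{\partial\mathbf{x}}\cdot\mathbf{f}(\mathbf{x},\mathbf{u}_E^*,\mathbf{u}_i^* )+g(t,\mathbf{x},\mathbf{u}_E^*,\mathbf{u}_i^* )$, with $g$ the running cost and $\mathbf{u}_E^*,\mathbf{u}_i^*$ the optimal controls. Here $\frac{\partial V}{\partial t}=0$ and $g=0$, so it becomes $\frac{\partial V}{\partial\mathbf{x}}\cdot\mathbf{f}(\mathbf{x},\mathbf{u}_E^*,\mathbf{u}_i^* )=0$. Barrier function and winning regions. The Barrier function is $$B(\mathbf{x})=(x_E-a(\mathbf{x}))^2+(y_E-b(\mathbf{x}))^2+z_E^2-(x_1-a(\mathbf{x}))^2-(y_1-b(\mathbf{x}))^2-z_1^2,$$ where, with $R_i^2=x_i^2+y_i^2+z_i^2$, $$a(\mathbf{x})=\frac12\,\frac{(y_2-y_3)R_1^2+(y_3-y_1)R_2^2+(y_1-y_2)R_3^2}{x_1(y_2-y_3)+x_2(y_3-y_1)+x_3(y_1-y_2)},\qquad b(\mathbf{x})=\frac12\,\frac{(x_3-x_2)R_1^2+(x_1-x_3)R_2^2+(x_2-x_1)R_3^2}{x_1(y_2-y_3)+x_2(y_3-y_1)+x_3(y_1-y_2)}.$$ The pursuers' winning region is $\mathcal{R}_p=\{\mathbf{x}\ |\ B(\mathbf{x})>0\}$ and the evader's winning region is $\mathcal{R}_e=\{\mathbf{x}\ |\ B(\mathb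f{x})<0\}$.
   Formalization: R_p is the part of {B>0} (z_E>0, ν_E≠0) from which the pursuers really win; strategies are locally Lipschitz; u_E*, u_i* are optimal as HJI saddle controls and as generating a min-max optimal play, since the literal feedback guarantees fail. *)

(* Defs.v *)
From HB Require Import structures.
From mathcomp Require Export all_boot all_order all_algebra.
From mathcomp Require Export all_classical all_reals all_analysis.

Set Implicit Arguments.
Unset Strict Implicit.
Unset Printing Implicit Defensive.

Import Order.TTheory GRing.Theory Num.Theory.
Export numFieldNormedType.Exports.

Local Open Scope classical_set_scope.
Local Open Scope ring_scope.

Section Game.
Variable R : realType.

(* A point of R^12: x.1 is the position of E, row i of x.2 that of P_(i+1).
   The velocity f(x, u_E, u_i) is then simply the pair of controls. *)
Definition state : Type := ('rV[R]_3 * 'M[R]_3)%type.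

Implicit Types (x : state) (xi : R -> state) (T v : R).
Implicit Types (sE : state -> 'rV[R]_3) (sP : state -> 'M[R]_3).

Definition sqnorm (u : 'rV[R]_3) : R := \sum_(k < 3) u 0 k ^+ 2.
Definition norm2 (u : 'rV[R]_3) : R := Num.sqrt (sqnorm u).

Definition controlE (u : 'rV[R]_3) : Prop := norm2 u = 1.
Definition controlP (u : 'M[R]_3) : Prop := forall i, norm2 (row i u) = 1.

Definition dynamics (uE : 'rV[R]_3) (uP : 'M[R]_3) : state := (uE, uP).

Definition captured x : Prop := exists i, row i x.2 = x.1.
Definition at_goal x : Prop := x.1 0 2 = 0.
Definition active x : Prop := 0 < x.1 0 2 /\ ~ captured x.

(* Local Lipschitz continuity on the non-terminal states is the usual condition
   under which a pair of feedback strategies generates exactly one play: since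
   all speeds are 1, the maximal solution either lasts forever or converges in
   finite time to a state with z_E = 0 or x_i = x_E. *)
Definition loc_lipschitz (W : normedModType R) (s : state -> W) : Prop :=
  forall x, active x -> exists2 A : set state, nbhs x A & [lipschitz s y | y in A].

Definition strategyE sE : Prop := (forall x, controlE (sE x)) /\ loc_lipschitz sE.
Definition strategyP sP : Prop := (forall x, controlP (sP x)) /\ loc_lipschitz sP.

(* Solutions and plays make sense for arbitrary feedback maps, in particular
   for those which are only meaningful on a part of the state space. *)
Definition solution sE sP x T xi : Prop :=
  [/\ xi 0 = x,
      {within `[0, T], continuous xi} &
      forall t : R, 0 < t < T ->
        is_derive t 1 xi (dynamics (sE (xi t)) (sP (xi t)))].

Definition terminating_play sE sP x T xi : Prop :=
  [/\ 0 < T,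
      solution sE sP x T xi,
      (forall t : R, 0 <= t < T -> active (xi t)) &
      captured (xi T) \/ at_goal (xi T)].

Definition endless_play sE sP x xi : Prop :=
  (forall T, 0 < T -> solution sE sP x T xi) /\
  (forall t : R, 0 <= t -> active (xi t)).

(* The payoff is z_E(t_f), which E minimizes; it is 0 exactly when E reaches
   the goal plane. A non-terminating play is worth +oo. *)
Definition payoff sE sP x (j : \bar R) : Prop :=
  (exists T xi, terminating_play sE sP x T xi /\ j = ((xi T).1 0 2)%:E) \/
  (exists xi, endless_play sE sP x xi /\ j = +oo%E).

(* max over u_i of J(sE, u_i; x) is at most v *)
Definition secures sE x v : Prop :=
  strategyE sE /\
  forall sP, strategyP sP -> forall j, payoff sE sP x j -> (j <= v%:E)%E.

(* v = min over u_E of max over u_i of J(u_E, u_i; x), the minimum over u_E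
   being attained *)
Definition is_value x v : Prop :=
  (exists sE, secures sE x v) /\
  (forall sE, strategyE sE -> exists2 sP, strategyP sP &
     forall j, payoff sE sP x j -> (v%:E <= j)%E).

(* Whatever E's strategy, the pursuers have an answer which prevents E from
   reaching the goal plane. *)
Definition pursuers_win x : Prop :=
  forall sE, strategyE sE -> exists2 sP, strategyP sP &
    exists2 j, payoff sE sP x j & (0 < j)%E.

(* The min-max optimal play: sE attains the minimum over u_E, and sP attains
   the maximum against sE. *)
Definition minimax_play x v sE sP T xi : Prop :=
  [/\ secures sE x v, strategyP sP, terminating_play sE sP x T xi &
      (xi T).1 0 2 = v].

(* Feedback maps which need not be defined and Lipschitz on all active states,
   such as uEstar and uPstar below, are optimal from x when they generate a
   min-max optimal play; p is the point where E and all the pursuers meet. *)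
Definition optimal_from sE sP x v (p : 'rV[R]_3) : Prop :=
  exists T xi, [/\ terminating_play sE sP x T xi,
    exists tE tP, minimax_play x v tE tP T xi,
    (xi T).1 = p & forall i, row i (xi T).2 = p].

Definition HJI (W : state -> R) x (uE : 'rV[R]_3) (uP : 'M[R]_3) : Prop :=
  'd W x (dynamics uE uP) = 0.

(* uE and uP are a saddle point of min over u_E, max over u_i of dW/dx . f *)
Definition HJI_optimal_controls (W : state -> R) x uE uP : Prop :=
  [/\ controlE uE, controlP uP,
      (forall u, controlE u ->
         'd W x (dynamics uE uP) <= 'd W x (dynamics u uP)) &
      (forall u, controlP u ->
         'd W x (dynamics uE u) <= 'd W x (dynamics uE uP))].

(* A is not assumed to be open: W has to be C^1 in a neighbourhood of each
   point of A. *)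
Definition C1_on (A : set state) (W : state -> R) : Prop :=
  forall x, A x -> \forall y \near x,
    differentiable W y /\ forall h : state, {for y, continuous (fun z => 'd W z h)}.

Section Formulas.
Variable x : state.

Local Notation xE := (x.1 0 0).
Local Notation yE := (x.1 0 1).
Local Notation zE := (x.1 0 2).
Local Notation x1 := (x.2 0 0).
Local Notation y1 := (x.2 0 1).
Local Notation z1 := (x.2 0 2).
Local Notation x2 := (x.2 1 0).
Local Notation y2 := (x.2 1 1).
Local Notation z2 := (x.2 1 2).
Local Notation x3 := (x.2 2 0).
Local Notation y3 := (x.2 2 1).
Local Notation z3 := (x.2 2 2).

Definition RE : R := norm2 x.1.
Definition RP (i : 'I_3) : R := norm2 (row i x.2).

Local Notation R1 := (RP 0).
Local Notation R2 := (RP 1).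
Local Notation R3 := (RP 2).

Definition nuE := x1 * (y2 - y3) + x2 * (y3 - y1) + x3 * (y1 - y2).
Definition nu1 := x2 * (y3 - yE) + x3 * (yE - y2) + xE * (y2 - y3).
Definition nu2 := x3 * (y1 - yE) + x1 * (yE - y3) + xE * (y3 - y1).
Definition nu3 := x1 * (y2 - yE) + x2 * (yE - y1) + xE * (y1 - y2).

Definition muE := y1 * (z2 - z3) + y2 * (z3 - z1) + y3 * (z1 - z2).
Definition mu1 := y2 * (z3 - zE) + y3 * (zE - z2) + yE * (z2 - z3).
Definition mu2 := y3 * (z1 - zE) + y1 * (zE - z3) + yE * (z3 - z1).
Definition mu3 := y1 * (z2 - zE) + y2 * (zE - z1) + yE * (z1 - z2).

Definition etaE := x1 * (z3 - z2) + x2 * (z1 - z3) + x3 * (z2 - z1).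
Definition eta1 := x2 * (zE - z3) + x3 * (z2 - zE) + xE * (z3 - z2).
Definition eta2 := x3 * (zE - z1) + x1 * (z3 - zE) + xE * (z1 - z3).
Definition eta3 := x1 * (zE - z2) + x2 * (z1 - zE) + xE * (z2 - z1).

Definition Lambda :=
  xE * (y3 * z1 - y1 * z3) + yE * (x1 * z3 - x3 * z1) + zE * (x3 * y1 - x1 * y3)
  - x2 * (y3 * (z1 - zE) + y1 * (zE - z3) + yE * (z3 - z1))
  - y2 * (x3 * (zE - z1) + x1 * (z3 - zE) + xE * (z1 - z3))
  - z2 * (x3 * (y1 - yE) + x1 * (yE - y3) + xE * (y3 - y1)).

Definition xstar : R :=
  (muE * RE ^+ 2 - mu1 * R1 ^+ 2 - mu2 * R2 ^+ 2 - mu3 * R3 ^+ 2) / (2 * Lambda).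
Definition ystar : R :=
  (etaE * RE ^+ 2 - eta1 * R1 ^+ 2 - eta2 * R2 ^+ 2 - eta3 * R3 ^+ 2) / (2 * Lambda).
Definition V : R :=
  (nuE * RE ^+ 2 - nu1 * R1 ^+ 2 - nu2 * R2 ^+ 2 - nu3 * R3 ^+ 2) / (2 * Lambda).

Definition interception : 'rV[R]_3 := \row_k [tuple xstar; ystar; V]`_k.

Definition dE : R := norm2 (interception - x.1).
Definition dP (i : 'I_3) : R := norm2 (interception - row i x.2).

Definition uEstar : 'rV[R]_3 := dE^-1 *: (interception - x.1).
Definition uPstar : 'M[R]_3 := \matrix_i ((dP i)^-1 *: (interception - row i x.2)).

Definition Ba : R :=
  2^-1 * (((y2 - y3) * R1 ^+ 2 + (y3 - y1) * R2 ^+ 2 + (y1 - y2) * R3 ^+ 2)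
          / (x1 * (y2 - y3) + x2 * (y3 - y1) + x3 * (y1 - y2))).
Definition Bb : R :=
  2^-1 * (((x3 - x2) * R1 ^+ 2 + (x1 - x3) * R2 ^+ 2 + (x2 - x1) * R3 ^+ 2)
          / (x1 * (y2 - y3) + x2 * (y3 - y1) + x3 * (y1 - y2))).
Definition barrier : R :=
  (xE - Ba) ^+ 2 + (yE - Bb) ^+ 2 + zE ^+ 2
  - (x1 - Ba) ^+ 2 - (y1 - Bb) ^+ 2 - z1 ^+ 2.

End Formulas.

(* The part of {B > 0} which is the pursuers' winning region: nuE x, the common
   denominator of a and b, has to be nonzero for B(x) to be defined, and B > 0
   alone does not prevent E from reaching the goal plane (for instance when the
   vertical projection of E is far outside the triangle formed by those of the
   pursuers). *)
Definition Rp : set state :=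
  [set x : state | [/\ 0 < x.1 0 2, nuE x != 0, 0 < barrier x & pursuers_win x]].

End Game.

(* Main.v *)
From HB Require Import structures.
Require Import Defs.
From mathcomp Require Import ring lra.

(** Since all speeds are equal, E reaches a point q before P_i exactly when q
    lies on E's side of the plane bisecting E and P_i, that is, when
    [gap x i q = |q - E|^2 - |q - P_i|^2] is negative. The three inequalities
    [gap x i q <= 0] cut out a convex cell around E.

    The pursuers can only win if the whole cell lies above the goal plane:
    otherwise E runs straight to a point of the cell with [z <= 0] and cannot
    be caught on the way ([pursuers_win_cell]). As the plane of the pursuers is
    not vertical ([nuE x != 0]), the height can only be bounded from below on
    the cell if the vectors P_i - E are linearly independent, which is
    [Lambda x != 0], and if the downward vertical is a nonnegative combination
    of them; its coefficients are [weight x i = nu_i / Lambda]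
    ([cone_analysis]). The cell is then a simplicial cone whose apex, the only
    point equidistant from the four players, is [interception x]; the identity
    [height] shows that no point of the cell is lower than the apex, whose
    height is [V x].

    E secures [V x] by running straight to the apex and beyond
    ([secures_straight]). Conversely, whatever E's feedback is, each pursuer can
    answer with the mirror image of E's velocity in the initial bisecting plane.
    P_i then stays the mirror image of E, so that E is captured as soon as it
    touches the plane: E never leaves the cell, and a terminating play ends at
    a height of at least [V x] ([mirror_secures]). The answer is a fixed linear
    image of E's feedback, hence a legitimate strategy.

    [V] is a rational function with denominator [2 * Lambda], hence C^1 where
    [Lambda] does not vanish. Because the apex stays equidistant from the four
    players when they move, the difference quotients of [V] have a simple form,
    which leads to
    [dV(h) = \sum_i weight i * ((p - P_i) . hP_i - (p - E) . hE)] with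
    [p = interception x] ([diff_V]). As the weights are nonnegative, the saddle
    point in the velocities is given by all players heading to p; as they are
    all at the same distance from p, the value of the saddle is 0. Finally, when
    they do so, the configuration shrinks homothetically towards p, which leaves
    the directions [uEstar] and [uPstar] unchanged, so that the straight motion
    is a play of these feedback maps ([winning_optimal]). *)

Set Implicit Arguments.
Unset Strict Implicit.
Unset Printing Implicit Defensive.

Import Order.TTheory GRing.Theory Num.Theory.

Local Open Scope classical_set_scope.
Local Open Scope ring_scope.

Ltac generalize_coords x :=
  move: (x.1 0 0) (x.1 0 1) (x.1 0 2) (x.2 0 0) (x.2 0 1) (x.2 0 2)
   (x.2 1 0) (x.2 1 1) (x.2 1 2) (x.2 2 0) (x.2 2 1) (x.2 2 2) => *.

(** * Euclidean geometry in dimension three *)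

Section Vectors.
Variable R : realType.
Implicit Types (u v w : 'rV[R]_3) (a : R).

Lemma sum3E (W : nmodType) (F : 'I_3 -> W) : \sum_(k < 3) F k = F 0 + F 1 + F 2.
Proof.
by rewrite !big_ord_recl big_ord0 addr0 addrA; congr (F _ + F _ + F _);
  exact: val_inj.
Qed.

Lemma ord3P (P : 'I_3 -> Prop) : P 0 -> P 1 -> P 2 -> forall i, P i.
Proof.
move=> P0 P1 P2 [[|[|[|//]]] lti].
- by rewrite (_ : Ordinal lti = 0) //; exact: val_inj.
- by rewrite (_ : Ordinal lti = 1) //; exact: val_inj.
- by rewrite (_ : Ordinal lti = 2) //; exact: val_inj.
Qed.

Lemma subrowE u v k : (u - v) 0 k = u 0 k - v 0 k.
Proof. by rewrite !mxE. Qed.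

Lemma addrowE u v k : (u + v) 0 k = u 0 k + v 0 k.
Proof. by rewrite !mxE. Qed.

Lemma scalerowE a u k : (a *: u) 0 k = a * u 0 k.
Proof. by rewrite !mxE. Qed.

Definition dot u v : R := \sum_(k < 3) u 0 k * v 0 k.

Lemma dotC u v : dot u v = dot v u.
Proof. by rewrite /dot !sum3E; ring. Qed.

Lemma dotDr u v w : dot u (v + w) = dot u v + dot u w.
Proof. by rewrite /dot !sum3E !mxE; ring. Qed.

Lemma dotBr u v w : dot u (v - w) = dot u v - dot u w.
Proof. by rewrite /dot !sum3E !mxE; ring. Qed.

Lemma dotZr a u v : dot u (a *: v) = a * dot u v.
Proof. by rewrite /dot !sum3E !mxE; ring. Qed.

Lemma dotNl u v : dot (- u) v = - dot u v.
Proof. by rewrite /dot !sum3E !mxE; ring. Qed.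

Lemma dotr0 u : dot u 0 = 0.
Proof. by rewrite /dot big1 // => k _; rewrite mxE mulr0. Qed.

Lemma dot_delta k u : dot (delta_mx 0 k) u = u 0 k.
Proof.
rewrite /dot (bigD1 k) //= big1 => [|j /negPf jk].
  by rewrite mxE !eqxx mul1r addr0.
by rewrite mxE eqxx jk mul0r.
Qed.

Lemma sqnormE u : sqnorm u = dot u u.
Proof. by rewrite /sqnorm /dot !sum3E; ring. Qed.

Lemma sqnormB u v : sqnorm (u - v) = sqnorm u - 2 * dot u v + sqnorm v.
Proof. by rewrite /sqnorm /dot !sum3E !mxE; ring. Qed.

Lemma sqnormZ a v : sqnorm (a *: v) = a ^+ 2 * sqnorm v.
Proof. by rewrite /sqnorm !sum3E !mxE; ring. Qed.

Lemma sqnorm_ge0 u : 0 <= sqnorm u.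
Proof. by rewrite sumr_ge0 // => k _; exact: sqr_ge0. Qed.

Lemma sqnorm_eq0 u : sqnorm u = 0 -> u = 0.
Proof.
move=> /eqP; rewrite psumr_eq0 => [|k _]; last exact: sqr_ge0.
move=> /allP u0; apply/rowP => k; rewrite mxE; apply/eqP.
by rewrite -sqrf_eq0; exact/u0/mem_index_enum.
Qed.

Lemma norm2_sq u : norm2 u ^+ 2 = sqnorm u.
Proof. by rewrite sqr_sqrtr // sqnorm_ge0. Qed.

Lemma norm2_gt0 v : v != 0 -> 0 < norm2 v.
Proof.
move=> v0; rewrite lt_def sqrtr_ge0 andbT; apply/eqP => n0.
by move/eqP: v0; apply; apply: sqnorm_eq0; rewrite -norm2_sq n0 expr0n.
Qed.

Lemma norm2Z a v : 0 <= a -> norm2 (a *: v) = a * norm2 v.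
Proof.
by move=> a0; rewrite /norm2 sqnormZ sqrtrM ?sqr_ge0 // sqrtr_sqr ger0_norm.
Qed.

Lemma norm2_normalized v : v != 0 -> norm2 ((norm2 v)^-1 *: v) = 1.
Proof.
move=> /norm2_gt0 n0.
by rewrite norm2Z ?invr_ge0 ?sqrtr_ge0 // mulVf // gt_eqF.
Qed.

Lemma dot_le_norm u v : 0 < norm2 v -> norm2 u = 1 -> dot v u <= norm2 v.
Proof.
move=> v0 u1; have := sqnorm_ge0 (v - norm2 v *: u).
rewrite sqnormB dotZr sqnormZ -!norm2_sq u1 => h.
by rewrite -(ler_pM2l v0) -subr_ge0; nra.
Qed.

Definition reflection w u : 'rV[R]_3 := u - (2 * dot w u / sqnorm w) *: w.

Lemma sqnorm_reflection w u : sqnorm w != 0 ->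
  sqnorm (reflection w u) = sqnorm u.
Proof.
by move=> w0; rewrite /reflection sqnormB dotZr (dotC u) sqnormZ; field.
Qed.

Lemma dot_reflection w u v : dot u (reflection w v) = dot (reflection w u) v.
Proof.
rewrite /reflection [RHS]dotC !dotBr !dotZr (dotC v u) (dotC v w) (dotC u w).
ring.
Qed.

Lemma reflectionB w u v :
  reflection w (u - v) = reflection w u - reflection w v.
Proof.
rewrite /reflection dotBr mulrBr mulrBl scalerBl.
by apply/rowP => k; rewrite !mxE; ring.
Qed.

(** The controls are measured by [norm2], whereas the Lipschitz conditions
    refer to the sup norm of matrices; the next four lemmas compare them. *)
Lemma mx_entry_le (m n : nat) (M : 'M[R]_(m, n)) i j : `|M i j| <= `|M|.
Proof.
by rewrite [leRHS]/Num.norm /= mx_normrE; exact: (le_bigmax _ _ (i, j)).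
Qed.

Lemma mx_norm_le (m n : nat) (M : 'M[R]_(m, n)) a : 0 <= a ->
  (forall i j, `|M i j| <= a) -> `|M| <= a.
Proof.
move=> a0 H; rewrite [leLHS]/Num.norm /= mx_normrE.
by apply: bigmax_le => // -[i j] _; exact: H.
Qed.

Lemma norm2_le u : norm2 u <= 2 * `|u|.
Proof.
rewrite -(@ler_pXn2r _ 2) ?nnegrE ?sqrtr_ge0 ?mulr_ge0 // norm2_sq /sqnorm.
have H k : u 0 k ^+ 2 <= `|u| ^+ 2.
  by rewrite -real_normK ?num_real // lerXn2r ?nnegrE // mx_entry_le.
have := sqr_ge0 `|u|; rewrite sum3E.
by have := H 0; have := H 1; have := H 2; nra.
Qed.

Lemma entry_le_norm2 u k : `|u 0 k| <= norm2 u.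
Proof.
rewrite -(@ler_pXn2r _ 2) ?nnegrE ?sqrtr_ge0 // norm2_sq /sqnorm.
rewrite real_normK ?num_real // (bigD1 k) //= lerDl.
by apply: sumr_ge0 => j _; exact: sqr_ge0.
Qed.

End Vectors.

(** * The cell of points that E reaches first *)

Section Cell.
Variable R : realType.
Implicit Types (x : state R) (u v p q : 'rV[R]_3) (s : R).

Definition sight x (i : 'I_3) : 'rV[R]_3 := row i x.2 - x.1.

Definition gap x i q := sqnorm (q - x.1) - sqnorm (q - row i x.2).

(** The rows are, up to the factor [- Lambda x], the basis dual to
    [sight x 0], [sight x 1], [sight x 2]; row 0 is for instance the cross
    product of [sight x 1] and [sight x 2]. *)
Definition dual_mx x : 'M[R]_3 :=
  \matrix_i \row_k
    [tuple [tuple mu1 x; eta1 x; nu1 x]`_k; [tuple mu2 x; eta2 x; nu2 x]`_k;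
           [tuple mu3 x; eta3 x; nu3 x]`_k]`_i.

Definition weight x i : R := dual_mx x i 2 / Lambda x.

Lemma dot_sight_dual x i j :
  dot (sight x i) (row j (dual_mx x)) = - Lambda x *+ (i == j).
Proof.
rewrite /dot sum3E.
move: i j; apply: ord3P; apply: ord3P;
  rewrite !mxE /= /mu1 /mu2 /mu3 /eta1 /eta2 /eta3 /nu1 /nu2 /nu3 /Lambda.
all: by generalize_coords x; ring.
Qed.

Lemma dual_expansion x v l :
  - Lambda x * v 0 l = \sum_i dual_mx x i l * dot (sight x i) v.
Proof.
rewrite /dot !sum3E; move: l; apply: ord3P;
  rewrite !mxE /= /mu1 /mu2 /mu3 /eta1 /eta2 /eta3 /nu1 /nu2 /nu3 /Lambda.
all: by generalize_coords x; move: (v 0 0) (v 0 1) (v 0 2) => *; ring.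
Qed.

(** The circumcentre of four points in Cramer form, with E as the origin. *)
Lemma interceptionE x : Lambda x != 0 ->
  interception x =
  x.1 - \sum_i (sqnorm (sight x i) / (2 * Lambda x)) *: row i (dual_mx x).
Proof.
move=> L0; apply/rowP => k; rewrite subrowE summxE sum3E.
have L20 : 2 * Lambda x != 0 by rewrite mulf_neq0 ?pnatr_eq0.
have D (L e a b c ca cb cc : R) : L != 0 ->
    L * (e - (a / L * ca + b / L * cb + c / L * cc)) =
    L * e - (a * ca + b * cb + c * cc) by move=> ?; field.
apply: (mulfI L20); rewrite !scalerowE D //.
move: k; apply: ord3P; rewrite !mxE /= /xstar /ystar /V [LHS]mulrC divfK //
  /RE /RP !norm2_sq /sqnorm !sum3E !mxE.
all: rewrite /mu1 /mu2 /mu3 /eta1 /eta2 /eta3 /nu1 /nu2 /nu3 /Lambda.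
all: by rewrite /muE /etaE /nuE; generalize_coords x; ring.
Qed.

Lemma gapE x i q :
  gap x i q = 2 * dot (sight x i) (q - x.1) - sqnorm (sight x i).
Proof. by rewrite /gap /sight /sqnorm /dot !sum3E !mxE; ring. Qed.

Lemma gap_evader x i : gap x i x.1 = - sqnorm (sight x i).
Proof. by rewrite gapE subrr dotr0 mulr0 sub0r. Qed.

Lemma gap_diff x i p q :
  gap x i q - gap x i p = 2 * dot (sight x i) (q - p).
Proof. by rewrite !gapE !dotBr; ring. Qed.

Lemma gap_ray x i v s :
  gap x i (x.1 + s *: v) = 2 * s * dot (sight x i) v - sqnorm (sight x i).
Proof. by rewrite gapE (addrAC x.1) subrr add0r dotZr mulrA. Qed.

Lemma gap_interception x i : Lambda x != 0 -> gap x i (interception x) = 0.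
Proof.
move=> L0; rewrite gapE interceptionE // addrAC subrr add0r sum3E.
rewrite -[- _]add0r !(dotBr, dotDr, dotZr) !dot_sight_dual dotr0.
by move: i; apply: ord3P; rewrite /= ?mulr0n ?mulr1n; field.
Qed.

Lemma interception_unique x q : Lambda x != 0 ->
  (forall i, gap x i q = 0) -> q = interception x.
Proof.
move=> L0 sq; apply/eqP; rewrite -subr_eq0; apply/eqP/rowP => l.
apply: (mulfI (x := - Lambda x)); first by rewrite oppr_eq0.
rewrite dual_expansion mxE mulr0 big1 // => i _.
have := gap_diff x i (interception x) q.
rewrite sq gap_interception // => /esym/eqP.
by rewrite subrr mulf_eq0 pnatr_eq0 /= => /eqP ->; rewrite mulr0.
Qed.

(** This is the identity [\sum_i weight x i *: sight x i = - e_z] paired with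
    [q - interception x]: it certifies that nonnegative weights make [V x] a
    lower bound of the height on the cell. *)
Lemma height x q : Lambda x != 0 ->
  q 0 2 - V x = - (\sum_i weight x i * gap x i q) / 2.
Proof.
move=> L0; have := dual_expansion x (q - interception x) 2.
rewrite subrowE [interception x _ _]mxE /= => H.
apply: (mulfI (x := - Lambda x)); first by rewrite oppr_eq0.
rewrite H (eq_bigr (fun i => dual_mx x i 2 * (gap x i q / 2))); last first.
  move=> i _; congr (_ * _); have := gap_diff x i (interception x) q.
  by rewrite gap_interception // subr0 => ->; field.
by rewrite /weight !sum3E; field.
Qed.

Lemma sum_weight x : \sum_i weight x i = nuE x / Lambda x.
Proof.
rewrite sum3E /weight -!mulrDl; congr (_ / _).
rewrite !mxE /= /nu1 /nu2 /nu3 /nuE.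
by generalize_coords x; ring.
Qed.

Lemma sight_gt0 x i : ~ captured x -> 0 < sqnorm (sight x i).
Proof.
move=> nc; rewrite lt_def sqnorm_ge0 andbT; apply/eqP => /sqnorm_eq0/eqP.
by rewrite subr_eq0 => /eqP c; apply: nc; exists i.
Qed.

(** The duality argument: if one of the first three conclusions failed, then an
    explicit point of the cell would not be above the goal plane. *)
Lemma cone_analysis x : ~ captured x -> 0 < x.1 0 2 -> nuE x != 0 ->
  (forall q, (forall i, gap x i q <= 0) -> 0 < q 0 2) ->
  [/\ Lambda x != 0, 0 < V x, forall i, 0 <= weight x i & V x < x.1 0 2].
Proof.
move=> nc zE0 nu0 D.
have L0 : Lambda x != 0.
  apply/eqP => L0.
  (* h is the normal of the plane of the pursuers. If E lies in this plane,
     then h is orthogonal to all lines of sight, and E can be moved along h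
     within the cell; nuE, the vertical component of h, is nonzero. *)
  pose h := row 0 (dual_mx x) + row 1 (dual_mx x) + row 2 (dual_mx x).
  have hz : h 0 2 = nuE x.
    by rewrite /h !mxE /= /nu1 /nu2 /nu3 /nuE; generalize_coords x; ring.
  have := D (x.1 - (x.1 0 2 / nuE x) *: h).
  rewrite subrowE scalerowE hz divfK // subrr ltxx => H.
  suff: false by []; apply: H => i.
  rewrite gapE (addrAC x.1) subrr dotBr dotZr !dotDr !dot_sight_dual L0 oppr0.
  by have := sqnorm_ge0 (sight x i); rewrite !mul0rn dotr0; lra.
have V0 : 0 < V x.
  have := D (interception x); rewrite mxE /=; apply => i.
  by rewrite gap_interception.
have w0 i : 0 <= weight x i.
  (* With a negative weight, the edge of the cell along which only the i-th
     inequality is strict would go down from the apex to the goal plane. *)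
  rewrite leNgt; apply/negP => wi.
  pose t := - V x / dual_mx x i 2.
  have c0 : dual_mx x i 2 != 0.
    by apply/eqP => c0; move: wi; rewrite /weight c0 mul0r ltxx.
  have := D (interception x - (- t) *: row i (dual_mx x)).
  rewrite subrowE scalerowE [interception x _ _]mxE [row i _ _ _]mxE /= /t.
  rewrite mulNr opprK divfK // subrr ltxx => H.
  suff: false by []; apply: H => j.
  rewrite -[leLHS]subr0 -[X in _ - X <= _](gap_interception j L0) gap_diff.
  rewrite addrAC subrr dotBr dotZr dot_sight_dual dotr0.
  case: eqP => _; rewrite ?mulr0n ?mulr1n; last by rewrite mulr0 subr0 mulr0.
  have -> : 2 * (0 - V x / dual_mx x i 2 * - Lambda x) = 2 * V x / weight x i.
    by rewrite /weight; field; rewrite L0 c0.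
  by rewrite mulr_ge0_le0 // ?invr_le0 ltW // mulr_gt0.
(* The height of E above the apex is half the sum of the numbers
   weight x i * |P_i - E|^2, and the weights do not all vanish. *)
split => //; rewrite -subr_gt0 height // lt_def; apply/andP; split; last first.
  rewrite divr_ge0 // oppr_ge0 sumr_le0 // => i _.
  by rewrite gap_evader mulr_ge0_le0 // oppr_le0 sqnorm_ge0.
rewrite mulf_neq0 ?invr_eq0 ?pnatr_eq0 // oppr_eq0; apply/negP.
rewrite (eq_bigr (fun i => - (weight x i * sqnorm (sight x i)))); last first.
  by move=> i _; rewrite gap_evader mulrN.
rewrite sumrN oppr_eq0 psumr_eq0 => [|i _]; last first.
  by rewrite mulr_ge0 ?sqnorm_ge0.
move=> /allP w; have : \sum_i weight x i != 0.
  by rewrite sum_weight mulf_neq0 ?invr_eq0.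
rewrite big1 ?eqxx // => i _; have := w i (mem_index_enum i).
by rewrite /= mulf_eq0 (gt_eqF (sight_gt0 i nc)) orbF => /eqP.
Qed.

(** What the proof uses of the winning region. *)
Definition winning x := [/\ active x, Lambda x != 0, 0 < V x,
  forall i, 0 <= weight x i & V x < x.1 0 2].

Lemma cell_height x q : winning x ->
  (forall i, gap x i q <= 0) -> V x <= q 0 2.
Proof.
move=> [_ L0 _ w0 _] Hq.
rewrite -subr_ge0 height // divr_ge0 // oppr_ge0.
by apply: sumr_le0 => i _; rewrite mulr_ge0_le0.
Qed.

Lemma interception_neq x : winning x -> interception x != x.1.
Proof.
by move=> [_ _ _ _ Vz]; apply/eqP => e; move: Vz; rewrite -e mxE /= ltxx.
Qed.

Lemma dE_gt0 x : winning x -> 0 < dE x.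
Proof. by move=> /interception_neq pE; rewrite norm2_gt0 // subr_eq0. Qed.

Lemma dPE x i : Lambda x != 0 -> dP x i = dE x.
Proof.
move=> L0; rewrite /dP /dE /norm2; congr Num.sqrt.
by have /eqP := gap_interception i L0; rewrite subr_eq0 => /eqP.
Qed.

Lemma uEstar_norm x : winning x -> norm2 (uEstar x) = 1.
Proof.
by move=> wx; apply: norm2_normalized; rewrite subr_eq0 interception_neq.
Qed.

Lemma uPstar_norm x i : winning x -> norm2 (row i (uPstar x)) = 1.
Proof.
move=> wx; have [_ L0 _ _ _] := wx.
rewrite rowK norm2Z ?invr_ge0 ?sqrtr_ge0 //.
by rewrite -/(dP x i) mulVf // dPE // gt_eqF // dE_gt0.
Qed.

Lemma dot_uEstar x : winning x ->
  dot (interception x - x.1) (uEstar x) = dE x.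
Proof.
move=> wx; rewrite dotZr -sqnormE -norm2_sq -/(dE x).
by field; rewrite gt_eqF // dE_gt0.
Qed.

Lemma dot_uPstar x i : winning x ->
  dot (interception x - row i x.2) (row i (uPstar x)) = dE x.
Proof.
move=> wx; have [_ L0 _ _ _] := wx.
rewrite rowK dotZr -sqnormE -norm2_sq -/(dP x i) dPE //.
by field; rewrite gt_eqF // dE_gt0.
Qed.

End Cell.

(** * Solutions of the equations of motion *)

Section Motion.
Variable R : realType.
Implicit Types (x y c : state R) (u v e : 'rV[R]_3) (xi : R -> state R) (T : R).

(** The inner product of R^12. Every linear functional of the state has this
    form, so that the mean value theorem for [state_dot c \o xi] provides all
    the information on solutions that is needed. *)
Definition state_dot c y : R :=
  dot c.1 y.1 + \sum_i dot (row i c.2) (row i y.2).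

Lemma state_dot_is_linear c : linear (state_dot c : state R -> R^o).
Proof.
by move=> a y z; rewrite /state_dot /dot !sum3E !mxE /GRing.scale /=; ring.
Qed.

HB.instance Definition _ c :=
  GRing.isLinear.Build R (state R) R^o _ (state_dot c) (state_dot_is_linear c).

Lemma continuous_posE k : continuous (fun y : state R => y.1 0 k).
Proof.
move=> y; apply: (@continuous_comp _ _ _ fst (fun u : 'rV[R]_3 => u 0 k)).
  exact: cvg_fst.
exact: coord_continuous.
Qed.

Lemma continuous_posP i k : continuous (fun y : state R => y.2 i k).
Proof.
move=> y; apply: (@continuous_comp _ _ _ snd (fun u : 'M[R]_3 => u i k)).
  exact: cvg_snd.
exact: coord_continuous.
Qed.

Lemma state_dot_continuous c : continuous (state_dot c).
Proof.
rewrite (_ : state_dot c = fun y => \sum_k c.1 0 k * y.1 0 k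
                     + \sum_i \sum_k c.2 i k * y.2 i k); last first.
  apply/funext => y; rewrite /state_dot /dot; congr (_ + _).
  by apply: eq_bigr => i _; apply: eq_bigr => k _; rewrite !mxE.
have cM a (f : state R -> R) y : f z @[z --> y] --> f y ->
    (a * f z @[z --> y] --> a * f y) by move=> ?; exact: cvgMl_tmp.
have cS (F : 'I_3 -> state R -> R) : (forall k, continuous (F k)) ->
    continuous (fun y => \sum_k F k y).
  move=> cF; rewrite (_ : (fun y => _) = fun y => F 0 y + F 1 y + F 2 y).
    by move=> y; do 2 ?apply: cvgD; exact: cF.
  by apply/funext => z; rewrite sum3E.
move=> y; apply: cvgD.
  by apply: cS => k z; apply: cM; exact: continuous_posE.
by apply: (cS) => i z; apply: cS => k {}z; apply: cM; exact: continuous_posP.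
Qed.

Lemma is_derive_state_dot c xi (t : R) (dx : state R) :
  is_derive t 1 xi dx -> is_derive t 1 (state_dot c \o xi) (state_dot c dx).
Proof.
move=> [dxi Dxi]; have dif : differentiable xi t by exact/derivable1_diffP.
have difo y : differentiable (state_dot c : state R -> R^o) y.
  exact/linear_differentiable/state_dot_continuous.
have dc : differentiable ((state_dot c : state R -> R^o) \o xi) t.
  exact: differentiable_comp.
apply: DeriveDef; first exact/derivable1_diffP.
rewrite deriveE // diff_comp //= diff_lin; last exact: state_dot_continuous.
by rewrite /= -deriveE // Dxi.
Qed.

Lemma solution_continuous c sE sP x T xi : solution sE sP x T xi ->
  {within `[0, T], continuous (state_dot c \o xi)}.
Proof.
move=> [_ cxi _] t.
apply: (@continuous_comp (subspace `[0, T]) _ _ xi (state_dot c)).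
  exact: cxi.
exact: state_dot_continuous.
Qed.

Lemma solution_mvt c sE sP x T xi : 0 < T -> solution sE sP x T xi ->
  exists2 t, 0 < t < T &
    state_dot c (xi T) =
    state_dot c x + state_dot c (dynamics (sE (xi t)) (sP (xi t))) * T.
Proof.
move=> T0 sol; have [<- _ dxi] := sol.
have [| |t] := @MVT R (state_dot c \o xi)
    (fun t => state_dot c (dynamics (sE (xi t)) (sP (xi t)))) 0 T T0.
- by move=> t; rewrite in_itv /= => /dxi; exact: is_derive_state_dot.
- exact: solution_continuous sol.
rewrite in_itv /= => t0T; rewrite subr0 => e; exists t => //.
by rewrite -e addrC subrK.
Qed.

Lemma solution_le sE sP x T' T xi : T' <= T ->
  solution sE sP x T xi -> solution sE sP x T' xi.
Proof.
move=> T'T [x0 cxi dxi]; split => //.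
- apply: continuous_subspaceW cxi => t /=; rewrite !in_itv /= => /andP[->].
  by move=> /le_trans; exact.
- by move=> t /andP[t0 tT']; apply: dxi; rewrite t0 (lt_le_trans tT').
Qed.

Definition onE u : state R := (u, 0).
Definition onP i u : state R := (0, delta_mx i 0 *m u).

Lemma state_dot_onE u y : state_dot (onE u) y = dot u y.1.
Proof.
rewrite /state_dot /= big1 ?addr0 // => i _.
by rewrite /dot sum3E !mxE; ring.
Qed.

Lemma state_dot_onP i u y : state_dot (onP i u) y = dot u (row i y.2).
Proof.
rewrite /state_dot /= /dot !sum3E !mxE !big_ord1 !mxE.
by move: i; apply: ord3P => /=; rewrite ?eqxx /=; ring.
Qed.

Lemma state_dotDl c c' y :
  state_dot (c + c') y = state_dot c y + state_dot c' y.
Proof. by rewrite /state_dot /dot !sum3E !mxE; ring. Qed.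

Lemma straight_evader e sP x T xi : 0 < T -> solution (cst e) sP x T xi ->
  (xi T).1 = x.1 + T *: e.
Proof.
move=> T0 sol; apply/rowP => k.
have [t _] := solution_mvt (onE (delta_mx 0 k)) T0 sol.
by rewrite !state_dot_onE !dot_delta !mxE mulrC.
Qed.

Lemma pursuer_speed i sE sP x T xi : strategyP sP -> 0 < T ->
  solution sE sP x T xi -> sqnorm (row i (xi T).2 - row i x.2) <= T ^+ 2.
Proof.
move=> [cP _] T0 sol; set v := _ - _.
(* With the displacement v itself as the functional, the mean value theorem
   yields |v|^2 = T (v . u) for some unit vector u, and 0 <= |v - T u|^2
   concludes. *)
have [t _] := solution_mvt (onP i v) T0 sol; rewrite !state_dot_onP => e.
have := sqnorm_ge0 (v - T *: row i (sP (xi t))).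
rewrite sqnormB dotZr sqnormZ -(norm2_sq (row i (sP (xi t)))) cP expr1n mulr1.
have : dot v v = T * dot v (row i (sP (xi t))).
  by rewrite {2}/v dotBr e /dynamics /=; ring.
by rewrite -sqnormE; lra.
Qed.

Lemma lipschitzP (U W : normedModType R) (f : U -> W) (A : set U) a : A a ->
  [lipschitz f y | y in A] <->
  exists k : R, forall y z : U, A y -> A z -> `|f y - f z| <= k * `|y - z|.
Proof.
move=> Aa; have PF : ProperFilter (globally (A `*` A)).
  exact: (@globally_properfilter _ _ (a, a)).
split.
  move=> /ex_dom_bound [k Hk]; exists k => y z Ay Az.
  exact: (Hk (y, z) (conj Ay Az)).
by move=> [k Hk]; apply: (@klipschitzW _ _ _ k) => -[y z] [/= Ay Az]; exact: Hk.
Qed.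

Lemma loc_lipschitz_cst (W : normedModType R) (e : W) :
  loc_lipschitz (cst e : state R -> W).
Proof.
move=> x _; exists setT; first exact: filterT.
apply/(lipschitzP _ (a := x)) => //; exists 0 => y z _ _.
by rewrite subrr normr0 mul0r.
Qed.

Lemma strategyE_cst e : norm2 e = 1 -> strategyE (cst e : state R -> 'rV[R]_3).
Proof. by move=> e1; split => //; exact: loc_lipschitz_cst. Qed.

Lemma strategyP_cst (e : 'M[R]_3) : (forall i, norm2 (row i e) = 1) ->
  strategyP (cst e : state R -> 'M[R]_3).
Proof. by move=> e1; split => //; exact: loc_lipschitz_cst. Qed.

End Motion.

(** * E runs straight *)

Section StraightRun.
Variable R : realType.
Implicit Types (x : state R) (e q : 'rV[R]_3) (xi : R -> state R) (T : R).

Lemma payoff_active sE sP x j : payoff sE sP x j -> active x.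
Proof.
move=> [[T [xi [[T0 [<- _ _] act _] _]]]|[xi [[sol act] _]]].
  by apply: act; rewrite lexx.
by have [<- _ _] := sol 1 ltr01; exact: act.
Qed.

Lemma pursuers_win_active x : pursuers_win x -> active x.
Proof.
move=> /(_ (cst (delta_mx 0 0))) [|sP _ [j pj _]]; last exact: payoff_active pj.
apply: strategyE_cst.
by rewrite /norm2 sqnormE dot_delta mxE !eqxx sqrtr1.
Qed.

Lemma straight_capture e sP x T xi : norm2 e = 1 -> strategyP sP -> 0 < T ->
  solution (cst e) sP x T xi -> captured (xi T) ->
  exists i, 0 <= gap x i (x.1 + T *: e).
Proof.
move=> e1 SP T0 sol [i ci]; exists i; have := pursuer_speed i SP T0 sol.
rewrite ci (straight_evader T0 sol) /gap => h.
rewrite (addrAC x.1) subrr add0r -(norm2_sq (T *: e)) (norm2Z _ (ltW T0)).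
by rewrite e1 mulr1 subr_ge0.
Qed.

(** The gap is affine along the run and negative at its start, so that it stays
    negative until q is reached. *)
Lemma straight_capture_late sP x q T xi : ~ captured x -> q != x.1 ->
  (forall i, gap x i q <= 0) -> strategyP sP -> 0 < T ->
  solution (cst ((norm2 (q - x.1))^-1 *: (q - x.1))) sP x T xi ->
  captured (xi T) -> norm2 (q - x.1) <= T.
Proof.
rewrite -subr_eq0 => nc v0 Hq SP T0 sol cap; set v := q - x.1 in v0 sol *.
have n0 := norm2_gt0 v0.
have [i] := straight_capture (norm2_normalized v0) SP T0 sol cap.
rewrite scalerA gap_ray => h; rewrite leNgt; apply/negP => Tn.
have r0 := sight_gt0 i nc; have := Hq i; rewrite gapE -/v => h2.
have s1 : T / norm2 v < 1 by rewrite ltr_pdivrMr // mul1r.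
have s0 : 0 < T / norm2 v by rewrite divr_gt0.
by nra.
Qed.

(** If q were a point of the cell with [q 0 2 <= 0], then running straight to q
    would make E cross the goal plane before any capture. *)
Lemma pursuers_win_cell x : pursuers_win x ->
  forall q, (forall i, gap x i q <= 0) -> 0 < q 0 2.
Proof.
move=> win q Hq; have [zE0 nc] := pursuers_win_active win.
rewrite ltNge; apply/negP => zq.
have qE : q != x.1 by apply: contraTneq zE0 => <-; rewrite -leNgt.
have v0 : q - x.1 != 0 by rewrite subr_eq0.
have n0 := norm2_gt0 v0.
have [sP SP [j + j0]] := win _ (strategyE_cst (norm2_normalized v0)).
have below T xi : 0 < T ->
    solution (cst ((norm2 (q - x.1))^-1 *: (q - x.1))) sP x T xi ->
    norm2 (q - x.1) <= T -> (xi T).1 0 2 <= 0.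
  move=> T0 sol le; rewrite (straight_evader T0 sol) scalerA.
  rewrite addrowE scalerowE subrowE.
  have s1 : 1 <= T / norm2 (q - x.1) by rewrite ler_pdivlMr // mul1r.
  by nra.
case=> [[T [xi [[T0 sol act fin] jE]]]|[xi [[sol act] _]]].
  rewrite jE lte_fin in j0.
  case: fin => [cap|goal]; last by rewrite goal ltxx in j0.
  have := straight_capture_late nc qE Hq SP T0 sol cap.
  by move=> /(below _ _ T0 sol); rewrite leNgt j0.
have := below _ _ n0 (sol _ n0) (lexx _).
by have [+ _] := act _ (ltW n0); rewrite leNgt => ->.
Qed.

Lemma Rp_winning x : Rp x -> winning x.
Proof.
move=> [zE nu0 _ win]; have act := pursuers_win_active win; have [_ nc] := act.
by have [] := cone_analysis nc zE nu0 (pursuers_win_cell win).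
Qed.

(** After passing the apex, E keeps descending at a constant rate, so that a
    later capture only lowers the payoff and the play cannot be endless. *)
Lemma secures_straight x : winning x -> secures (cst (uEstar x)) x (V x).
Proof.
move=> wx; have [[zE nc] L0 V0 w0 Vz] := wx; have d0 := dE_gt0 wx.
have e1 := uEstar_norm wx; split; first exact: strategyE_cst.
have zT sP T xi : 0 < T -> solution (cst (uEstar x)) sP x T xi ->
   (xi T).1 0 2 = x.1 0 2 + T / dE x * (V x - x.1 0 2).
  move=> T0 sol; rewrite (straight_evader T0 sol) /uEstar scalerA.
  by rewrite addrowE scalerowE subrowE [interception x _ _]mxE.
move=> sP SP j [[T [xi [[T0 sol act fin] ->]]]|[xi [[sol act] _]]].
  rewrite lee_fin; case: fin => [cap|goal]; last by rewrite goal ltW.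
  have Hp i : gap x i (interception x) <= 0 by rewrite gap_interception.
  have := straight_capture_late nc (interception_neq wx) Hp SP T0 sol cap.
  rewrite -/(dE x) (zT _ _ _ T0 sol) => dT.
  have : 1 <= T / dE x by rewrite ler_pdivlMr // mul1r.
  by rewrite -subr_ge0 -subr_le0; nra.
(* T is the time at which E crosses the goal plane. *)
pose T := dE x * x.1 0 2 / (x.1 0 2 - V x).
have T0 : 0 < T by rewrite divr_gt0 ?mulr_gt0 ?subr_gt0.
have [+ _] := act _ (ltW T0); rewrite (zT _ _ _ T0 (sol _ T0)) /T.
have -> : x.1 0 2 + dE x * x.1 0 2 / (x.1 0 2 - V x) / dE x * (V x - x.1 0 2) = 0.
  by field; rewrite gt_eqF //= subr_eq0 gt_eqF.
by rewrite ltxx.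
Qed.

End StraightRun.

(** * The pursuers mirror E *)

Section Mirror.
Variable R : realType.
Implicit Types (x y : state R) (xi : R -> state R) (T : R).
Implicit Types (sE : state R -> 'rV[R]_3).

(** The reflections are those of the initial state x, not of the current state
    y: this makes the answer a linear function of [sE y], and its Lipschitz
    continuity immediate. *)
Definition mirror x sE y : 'M[R]_3 := \matrix_i reflection (sight x i) (sE y).

Lemma strategyP_mirror x sE : ~ captured x -> strategyE sE ->
  strategyP (mirror x sE).
Proof.
move=> nc [c1 lip].
have w0 i : sqnorm (sight x i) != 0 by rewrite gt_eqF // sight_gt0.
split=> [y i|y ay].
  by rewrite rowK /norm2 sqnorm_reflection //; exact: c1.
have [A nA] := lip y ay.
move=> /(lipschitzP _ (nbhs_singleton nA)) [k Hk]; exists A => //.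
apply/(lipschitzP _ (nbhs_singleton nA)); exists (2 * k) => a b Aa Ab.
have kab0 := le_trans (normr_ge0 _) (Hk a b Aa Ab).
apply: mx_norm_le => [|i j]; first by rewrite -mulrA mulr_ge0.
rewrite (_ : _ i j = reflection (sight x i) (sE a - sE b) 0 j); last first.
  by rewrite reflectionB !mxE.
apply: le_trans (entry_le_norm2 _ _) _.
rewrite /norm2 sqnorm_reflection //; apply: le_trans (norm2_le _) _.
by rewrite -mulrA ler_pM2l // Hk.
Qed.

(** P_i remains the image of E in the initial bisecting plane: the difference
    between P_i and the reflected evader has derivative 0. *)
Lemma mirror_invariant x sE T xi i : ~ captured x -> 0 < T ->
  solution sE (mirror x sE) x T xi ->
  row i (xi T).2 - (xi T).1
    = - (gap x i (xi T).1 / sqnorm (sight x i)) *: sight x i.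
Proof.
move=> nc T0 sol.
have w0 : sqnorm (sight x i) != 0 by rewrite gt_eqF // sight_gt0.
have E : row i (xi T).2 - row i x.2 = reflection (sight x i) ((xi T).1 - x.1).
  apply/rowP => k; rewrite -!dot_delta dot_reflection !dotBr.
  have [t _] := solution_mvt
    (onP i (delta_mx 0 k) + onE (- reflection (sight x i) (delta_mx 0 k))) T0 sol.
  rewrite !state_dotDl !state_dot_onP !state_dot_onE !dotNl /= rowK.
  by rewrite dot_reflection => e; lra.
have -> : row i (xi T).2 = row i x.2 + reflection (sight x i) ((xi T).1 - x.1).
  by rewrite -E addrC subrK.
rewrite gapE /reflection; apply/rowP => k.
rewrite !(subrowE, scalerowE, mxE).
by move: w0; set s := sqnorm _; set d := dot _ _ => w0; field.
Qed.

(** If E left the cell, it would meet a bisecting plane at some earlier time,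
    and would be captured there. *)
Lemma mirror_confines x sE T xi i : active x -> 0 < T ->
  solution sE (mirror x sE) x T xi ->
  (forall t, 0 <= t < T -> active (xi t)) -> gap x i (xi T).1 <= 0.
Proof.
move=> [zE nc] T0 sol act; rewrite leNgt; apply/negP => sT.
have r0 := sight_gt0 i nc.
pose g := state_dot (onE (sight x i)) \o xi.
have gE t : gap x i (xi t).1 =
    2 * (g t - dot (sight x i) x.1) - sqnorm (sight x i).
  by rewrite gapE /g /= state_dot_onE dotBr.
have x0 : xi 0 = x by case: sol.
have g0 : g 0 = dot (sight x i) x.1 by rewrite /g /= state_dot_onE x0.
have [|c] := @IVT R g 0 T (dot (sight x i) x.1 + sqnorm (sight x i) / 2) (ltW T0)
  (solution_continuous sol (c := _)).
  by have := gE T; rewrite g0 ge_min le_max => e; apply/andP; split; apply/orP;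
    [left|right]; lra.
rewrite in_itv /= => /andP[c0 cT] gc.
have sc : gap x i (xi c).1 = 0 by rewrite gE gc; field.
have cT' : c < T.
  rewrite lt_def cT andbT; apply: contra_eqN sc => /eqP <-.
  by rewrite gt_eqF.
have c0' : 0 < c.
  rewrite lt_def c0 andbT; apply: contra_eqN sc => /eqP ->.
  by rewrite gE g0 subrr mulr0 sub0r oppr_eq0 gt_eqF.
have [_ []] : active (xi c) by apply: act; rewrite c0.
exists i; apply/eqP; rewrite -subr_eq0.
rewrite (mirror_invariant i nc c0' (solution_le (ltW cT') sol)) sc.
by rewrite mul0r oppr0 scale0r.
Qed.

Lemma mirror_secures x sE : winning x -> strategyE sE ->
  exists2 sP, strategyP sP &
     forall j, payoff sE sP x j -> ((V x)%:E <= j)%E.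
Proof.
move=> wx SE; have [ax _ _ _ _] := wx; have [_ nc] := ax.
exists (mirror x sE); first exact: strategyP_mirror.
move=> j [[T [xi [[T0 sol act fin] ->]]]|[xi [_ ->]]]; last by rewrite leey.
by rewrite lee_fin; apply: cell_height => // i; exact: mirror_confines sol act.
Qed.

Lemma winning_value x : winning x -> is_value x (V x).
Proof.
move=> wx; split; first by exists (cst (uEstar x)); exact: secures_straight.
by move=> sE; exact: mirror_secures.
Qed.

End Mirror.

(** * Smoothness of V *)

Section Smoothness.
Variable R : realType.
Implicit Types (f g : state R -> R) (x y z h : state R).

Definition C1_at f y := (\forall z \near y, differentiable f z) /\
  forall h, {for y, continuous (fun z => 'd f z h)}.

Lemma C1_at_continuous f y : C1_at f y -> {for y, continuous f}.
Proof. by move=> [/nbhs_singleton df _]; exact: differentiable_continuous. Qed.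

Lemma C1_at_rule f y (F : state R -> state R -> R) :
  (\forall z \near y, differentiable f z /\ forall h, 'd f z h = F z h) ->
  (forall h, {for y, continuous (F^~ h)}) -> C1_at f y.
Proof.
move=> df cF; split; first by apply: filterS df => z [].
move=> h.
have e : 'd f y h = F y h by have [_] := nbhs_singleton df; exact.
have near_e : \forall z \near y, F z h = 'd f z h.
  by apply: filterS df => z [_ /(_ h)].
have : 'd f z h @[z --> y] --> F y h.
  exact: cvg_trans (near_eq_cvg near_e) (cF h).
by rewrite -e.
Qed.

Lemma C1_at_state_dot c y : C1_at (state_dot c) y.
Proof.
pose L := state_dot c : {linear state R -> R^o}.
apply: (@C1_at_rule _ _ (fun _ h => state_dot c h)) => [|h]; last exact: cvg_cst.
apply: filterE => z; split.
  exact: (linear_differentiable (f := L) _ (@state_dot_continuous _ c)).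
by move=> h; rewrite (diff_lin (f := L) _ (@state_dot_continuous _ c)).
Qed.

Lemma C1_at_posE k y : C1_at (fun z => z.1 0 k) y.
Proof.
rewrite (_ : (fun _ => _) = state_dot (onE (delta_mx 0 k))).
  exact: C1_at_state_dot.
by apply/funext => z; rewrite state_dot_onE dot_delta.
Qed.

Lemma C1_at_posP i k y : C1_at (fun z => z.2 i k) y.
Proof.
rewrite (_ : (fun _ => _) = state_dot (onP i (delta_mx 0 k))).
  exact: C1_at_state_dot.
by apply/funext => z; rewrite state_dot_onP dot_delta mxE.
Qed.

Lemma C1_at_cst (a : R) y : C1_at (fun=> a) y.
Proof.
apply: (@C1_at_rule _ _ (fun _ _ => 0)) => [|h]; last exact: cvg_cst.
apply: filterE => z; split; first exact: differentiable_cst.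
by move=> h; exact: (congr1 (@^~ h) (diff_cst a z)).
Qed.

Lemma C1_at_add f g y :
  C1_at f y -> C1_at g y -> C1_at (fun z => f z + g z) y.
Proof.
move=> [df cf] [dg cg].
apply: (@C1_at_rule _ _ (fun z h => 'd f z h + 'd g z h)) => [|h].
  apply: filterS2 df dg => z dfz dgz; split; first exact: differentiableD.
  by move=> h; exact: (congr1 (@^~ h) (diffD dfz dgz)).
exact: cvgD (cf h) (cg h).
Qed.

Lemma C1_at_opp f y : C1_at f y -> C1_at (fun z => - f z) y.
Proof.
move=> [df cf].
apply: (@C1_at_rule _ _ (fun z h => - 'd f z h)) => [|h].
  apply: filterS df => z dfz; split; first exact: differentiableN.
  by move=> h; exact: (congr1 (@^~ h) (diffN dfz)).
exact: cvgN (cf h).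
Qed.

Lemma C1_at_mul f g y :
  C1_at f y -> C1_at g y -> C1_at (fun z => f z * g z) y.
Proof.
move=> Cf Cg; have [df cf] := Cf; have [dg cg] := Cg.
apply: (@C1_at_rule _ _ (fun z h => f z * 'd g z h + g z * 'd f z h)) => [|h].
  apply: filterS2 df dg => z dfz dgz; split; first exact: differentiableM.
  by move=> h; exact: (congr1 (@^~ h) (diffM dfz dgz)).
by apply: cvgD; apply: cvgM; [exact: C1_at_continuous Cf|exact: cg h|
                              exact: C1_at_continuous Cg|exact: cf h].
Qed.

Lemma C1_at_inv f y : f y != 0 -> C1_at f y -> C1_at (fun z => (f z)^-1) y.
Proof.
move=> fy0 Cf; have [df cf] := Cf; have cont := C1_at_continuous Cf.
have nf0 : \forall z \near y, f z != 0 by exact: (cvgr_neq0 _ cont).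
apply: (@C1_at_rule _ _ (fun z h => - (f z) ^- 2 * 'd f z h)) => [|h].
  apply: filterS2 df nf0 => z dfz f0; split; first exact: differentiableV.
  by move=> h; exact: (congr1 (@^~ h) (diffV dfz f0)).
apply: cvgM; last exact: cf.
apply: cvgN; apply: cvgV; first by rewrite expf_neq0.
by rewrite !expr2; exact: cvgM.
Qed.

Ltac C1_poly :=
  repeat lazymatch goal with
  | |- C1_at (fun z => (@?a z + @?b z)%R) ?y => apply: (@C1_at_add a b y)
  | |- C1_at (fun z => (- @?a z)%R) ?y => apply: (@C1_at_opp a y)
  | |- C1_at (fun z => (@?a z * @?b z)%R) ?y => apply: (@C1_at_mul a b y)
  | |- C1_at (fun z => fun_of_matrix (fst z) _ _) ?y => exact: C1_at_posE
  | |- C1_at (fun z => fun_of_matrix (snd z) _ _) ?y => exact: C1_at_posP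
  end.

Lemma C1_at_Lambda y : C1_at (@Lambda R) y.
Proof. by rewrite /Lambda; C1_poly. Qed.

Lemma C1_at_RE2 y : C1_at (fun z => RE z ^+ 2) y.
Proof.
rewrite (_ : (fun _ => _) = fun z =>
    z.1 0 0 * z.1 0 0 + z.1 0 1 * z.1 0 1 + z.1 0 2 * z.1 0 2).
  by C1_poly.
by apply/funext => z; rewrite /RE norm2_sq /sqnorm sum3E !expr2.
Qed.

Lemma C1_at_RP2 i y : C1_at (fun z => RP z i ^+ 2) y.
Proof.
rewrite (_ : (fun _ => _) = fun z =>
    z.2 i 0 * z.2 i 0 + z.2 i 1 * z.2 i 1 + z.2 i 2 * z.2 i 2).
  by C1_poly.
by apply/funext => z; rewrite /RP norm2_sq /sqnorm sum3E !mxE !expr2.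
Qed.

(** The common shape of the coordinates of the interception point. *)
Lemma C1_at_quotient (e a b c : state R -> R) y : Lambda y != 0 ->
  C1_at e y -> C1_at a y -> C1_at b y -> C1_at c y ->
  C1_at (fun z => (e z * RE z ^+ 2 - a z * RP z 0 ^+ 2 - b z * RP z 1 ^+ 2
                   - c z * RP z 2 ^+ 2) / (2 * Lambda z)) y.
Proof.
move=> L0 Ce Ca Cb Cc; apply: C1_at_mul; last first.
  apply: C1_at_inv; first by rewrite mulf_neq0 ?pnatr_eq0.
  by apply: C1_at_mul; [exact: C1_at_cst|exact: C1_at_Lambda].
have CP f i : C1_at f y -> C1_at (fun z => - (f z * RP z i ^+ 2)) y.
  by move=> Cf; apply: C1_at_opp; exact: C1_at_mul Cf (C1_at_RP2 i y).
have CE : C1_at (fun z => e z * RE z ^+ 2) y := C1_at_mul Ce (C1_at_RE2 y).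
exact: C1_at_add (C1_at_add (C1_at_add CE (CP _ 0 Ca)) (CP _ 1 Cb)) (CP _ 2 Cc).
Qed.

Lemma C1_at_V y : Lambda y != 0 -> C1_at (@V R) y.
Proof.
by move=> L0; apply: (C1_at_quotient L0); rewrite /nuE /nu1 /nu2 /nu3; C1_poly.
Qed.

Lemma C1_at_xstar y : Lambda y != 0 -> C1_at (@xstar R) y.
Proof.
by move=> L0; apply: (C1_at_quotient L0); rewrite /muE /mu1 /mu2 /mu3; C1_poly.
Qed.

Lemma C1_at_ystar y : Lambda y != 0 -> C1_at (@ystar R) y.
Proof.
move=> L0; apply: (C1_at_quotient L0); rewrite /etaE /eta1 /eta2 /eta3.
all: by C1_poly.
Qed.

Lemma near_Lambda x : Lambda x != 0 -> \forall y \near x, @Lambda R y != 0.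
Proof. exact: (cvgr_neq0 _ (C1_at_continuous (C1_at_Lambda x))). Qed.

Lemma C1_on_V (A : set (state R)) : (forall x, A x -> Lambda x != 0) ->
  C1_on A (@V R).
Proof.
move=> AL x /AL /near_Lambda; apply: filterS => y /C1_at_V.
by move=> [/nbhs_singleton dV cV].
Qed.

Lemma interception_continuous x k : Lambda x != 0 ->
  {for x, continuous (fun y => interception y 0 k)}.
Proof.
move=> L0; apply: C1_at_continuous; move: k; apply: ord3P.
- rewrite (_ : (fun _ => _) = @xstar R); first exact: C1_at_xstar.
  by apply/funext => y; rewrite mxE.
- rewrite (_ : (fun _ => _) = @ystar R); first exact: C1_at_ystar.
  by apply/funext => y; rewrite mxE.
- rewrite (_ : (fun _ => _) = @V R); first exact: C1_at_V.
  by apply/funext => y; rewrite mxE.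
Qed.

End Smoothness.

(** * The gradient of V and the HJI equation *)

Section HJI.
Variable R : realType.
Implicit Types (x y h : state R) (p : 'rV[R]_3) (t : R).

(** For [p = interception x] this is the differential of V at x. The point p
    is a separate argument because, at [p = interception (t *: h + x)], the
    formula yields the difference quotients as well. *)
Definition V_gradient x p h : R :=
  \sum_i weight x i * (dot (p - row i x.2) (row i h.2) - dot (p - x.1) h.1).

Lemma V_gradient_cvg x h : Lambda x != 0 ->
  V_gradient x (interception y) h @[y --> x] -->
  V_gradient x (interception x) h.
Proof.
move=> L0.
have cD v u : dot (interception y - v) u @[y --> x] --> dot (interception x - v) u.
  have E y : dot (interception y - v) u =
      interception y 0 0 * u 0 0 + interception y 0 1 * u 0 1
        + interception y 0 2 * u 0 2 - dot v u.
    by rewrite /dot !sum3E !mxE /=; ring.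
  rewrite E (funext E).
  apply: cvgB; last exact: cvg_cst.
  have cI k : interception y 0 k * u 0 k @[y --> x] --> interception x 0 k * u 0 k.
    by apply: cvgMr_tmp; exact: interception_continuous.
  exact: cvgD (cvgD (cI 0) (cI 1)) (cI 2).
pose F i y := weight x i *
  (dot (interception y - row i x.2) (row i h.2) - dot (interception y - x.1) h.1).
have cW i : F i y @[y --> x] --> F i x.
  by apply: cvgMl_tmp; apply: cvgB; exact: cD.
have E y : V_gradient x (interception y) h = F 0 y + F 1 y + F 2 y.
  by rewrite /V_gradient sum3E.
rewrite E (funext E).
exact: cvgD (cvgD (cW 0) (cW 1)) (cW 2).
Qed.

(** With [q = interception (t *: h + x)], [height] at x expresses the increment
    of V by the numbers [gap x i q]. They are compared with the gaps of q at
    [t *: h + x], which vanish. *)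
Lemma increment_V x h t :
  Lambda x != 0 -> Lambda (t *: h + x) != 0 -> t != 0 ->
  t^-1 * (V (t *: h + x) - V x) =
  V_gradient x (interception (t *: h + x)) h
  + t * (\sum_i weight x i * (sqnorm h.1 - sqnorm (row i h.2)) / 2).
Proof.
move=> L0 Lt t0; set y := t *: h + x; set q := interception y.
have -> : V y = q 0 2 by rewrite mxE.
rewrite height // /V_gradient !sum3E.
have S i : gap x i q =
    2 * t * (dot (q - x.1) h.1 - dot (q - row i x.2) (row i h.2))
    - t ^+ 2 * (sqnorm h.1 - sqnorm (row i h.2)).
  rewrite -[LHS]subr0 -(gap_interception i Lt) -/q /gap /y /=.
  have -> : q - (t *: h.1 + x.1) = (q - x.1) - t *: h.1.
    by rewrite opprD addrA addrAC.
  have -> : q - row i (t *: h.2 + x.2) = (q - row i x.2) - t *: row i h.2.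
    by apply/rowP => k; rewrite !mxE opprD addrA addrAC.
  by rewrite !sqnormB !dotZr !sqnormZ; ring.
by rewrite !S; field.
Qed.

Lemma diff_V x h : Lambda x != 0 ->
  'd (@V R) x h = V_gradient x (interception x) h.
Proof.
move=> L0; have [/nbhs_singleton dV _] := C1_at_V L0.
rewrite -deriveE //; apply: cvg_lim => //.
have c0 : t *: h + x @[t --> (0 : R)] --> x.
  have : t *: h + x @[t --> (0 : R)] --> 0 *: h + x.
    by apply: cvgD; [apply: cvgZr_tmp; exact: cvg_id|exact: cvg_cst].
  by rewrite scale0r add0r.
have near_eq : \forall t \near (0 : R)^',
   V_gradient x (interception (t *: h + x)) h
     + t * (\sum_i weight x i * (sqnorm h.1 - sqnorm (row i h.2)) / 2)
   = t^-1 *: ((@V R \o shift x) (t *: h) - V x).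
  near=> t; rewrite -increment_V //; last by near: t; exact: nbhs_dnbhs_neq.
  by near: t; apply: nbhs_dnbhs; exact: (c0 _ (near_Lambda L0)).
apply: cvg_trans (near_eq_cvg near_eq) _; apply: cvg_within_filter.
have cK := cvg_comp _ _ c0 (@V_gradient_cvg x h L0).
set C := \sum_i _.
have cT : t * C @[t --> (0 : R)] --> 0 * C.
  by apply: cvgMr_tmp; exact: cvg_id.
by have := cvgD cK cT; rewrite mul0r addr0; exact.
Unshelve. all: by end_near. Qed.

Lemma V_HJI x : winning x -> HJI (@V R) x (uEstar x) (uPstar x).
Proof.
move=> wx; have [_ L0 _ _ _] := wx.
rewrite /HJI diff_V // /V_gradient big1 // => i _.
by rewrite dot_uPstar // dot_uEstar // subrr mulr0.
Qed.

Lemma V_HJI_saddle x : winning x ->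
  HJI_optimal_controls (@V R) x (uEstar x) (uPstar x).
Proof.
move=> wx; have [_ L0 _ w0 _] := wx; have d0 := dE_gt0 wx.
have cE : controlE (uEstar x) by exact: uEstar_norm.
have cP : controlP (uPstar x) by move=> i; exact: uPstar_norm.
split => // [u cu|u cu]; rewrite !diff_V //;
  apply: ler_sum => i _; apply: ler_wpM2l => //=.
  by rewrite lerD2l lerN2 dot_uEstar // dot_le_norm.
rewrite lerD2r dot_uPstar // -(dPE i L0) dot_le_norm //.
by rewrite -/(dP x i) dPE.
Qed.

End HJI.

(** * The optimal play *)

Section OptimalPlay.
Variable R : realType.
Implicit Types (x y : state R) (p : 'rV[R]_3) (s t : R).

(** y is the image of x under the homothety of centre p and ratio s. *)
Definition shrunk x p s y := y.1 = p - s *: (p - x.1) /\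
  forall i, row i y.2 = p - s *: (p - row i x.2).

Lemma Lambda_shrunk x p s y : shrunk x p s y -> Lambda y = s ^+ 3 * Lambda x.
Proof.
move=> [yE yP].
have e k : y.1 0 k = p 0 k - s * (p 0 k - x.1 0 k) by rewrite yE !mxE.
have r i k : y.2 i k = p 0 k - s * (p 0 k - x.2 i k).
  by have /rowP/(_ k) := yP i; rewrite !mxE.
rewrite /Lambda !e !r; move: (p 0 0) (p 0 1) (p 0 2).
by generalize_coords x; ring.
Qed.

Lemma interception_shrunk x s y : Lambda x != 0 -> s != 0 ->
  shrunk x (interception x) s y -> interception y = interception x.
Proof.
move=> L0 s0 sy; apply/esym/interception_unique.
  by rewrite (Lambda_shrunk sy) mulf_neq0 ?expf_neq0.
move=> i; case: sy => yE yP; rewrite /gap yE yP !subKr !sqnormZ.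
have /eqP := gap_interception i L0.
by rewrite subr_eq0 => /eqP ->; rewrite subrr.
Qed.

Lemma uEstar_shrunk x s y : Lambda x != 0 -> 0 < s ->
  shrunk x (interception x) s y -> uEstar y = uEstar x.
Proof.
move=> L0 s0 sy; rewrite /uEstar /dE.
rewrite (interception_shrunk L0 (lt0r_neq0 s0) sy).
case: sy => -> _; rewrite subKr norm2Z ?ltW // scalerA invfM -mulrA mulrCA.
by rewrite mulVf ?mulr1 // lt0r_neq0.
Qed.

Lemma uPstar_shrunk x s y : Lambda x != 0 -> 0 < s ->
  shrunk x (interception x) s y -> uPstar y = uPstar x.
Proof.
move=> L0 s0 sy; apply/row_matrixP => i; rewrite !rowK /dP.
rewrite (interception_shrunk L0 (lt0r_neq0 s0) sy).
case: sy => _ ->; rewrite subKr norm2Z ?ltW // scalerA invfM -mulrA mulrCA.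
by rewrite mulVf ?mulr1 // lt0r_neq0.
Qed.

Definition straight_play x t : state R :=
  x + t *: dynamics (uEstar x) (uPstar x).

Lemma straight_play_shrunk x t : winning x ->
  shrunk x (interception x) (1 - t / dE x) (straight_play x t).
Proof.
move=> wx; have [_ L0 _ _ _] := wx.
have H v : v + t *: ((dE x)^-1 *: (interception x - v)) =
  interception x - (1 - t / dE x) *: (interception x - v).
  by apply/rowP => k; rewrite subrowE addrowE !scalerowE !subrowE; ring.
split; first exact: H.
move=> i; rewrite (_ : (straight_play x t).2 = x.2 + t *: uPstar x) //.
by rewrite linearD linearZ /= rowK dPE // H.
Qed.

Lemma straight_play_continuous x : continuous (straight_play x).
Proof.
move=> t; apply: cvgD; first exact: cvg_cst.
by apply: cvgZr_tmp; exact: cvg_id.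
Qed.

Lemma straight_play_derive x t :
  is_derive t 1 (straight_play x) (dynamics (uEstar x) (uPstar x)).
Proof.
set u := dynamics _ _.
have du : is_derive t 1 ( *:%R^~ u : R -> state R) u.
  have [dif e] := is_diff_scalel t u.
  apply: DeriveDef; first exact/derivable1_diffP.
  by rewrite deriveE // e scale1r.
by have := is_deriveD (is_derive_cst x t 1) du; rewrite add0r.
Qed.

Lemma straight_play_active x t : winning x -> 0 <= t < dE x ->
  active (straight_play x t).
Proof.
move=> wx /andP[t0 td]; have [_ L0 V0 _ Vz] := wx; have d0 := dE_gt0 wx.
have s0 : 0 < 1 - t / dE x by rewrite subr_gt0 ltr_pdivrMr // mul1r.
have s1 : t / dE x >= 0 by rewrite divr_ge0 // ltW.
have sh := straight_play_shrunk t wx; split.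
  case: sh => -> _; rewrite subrowE scalerowE subrowE [interception x _ _]mxE /=.
  by nra.
(* A captured state has a vanishing line of sight, hence Lambda = 0. *)
move=> [i ci]; have : Lambda (straight_play x t) != 0.
  by rewrite (Lambda_shrunk sh) mulf_neq0 ?expf_neq0 // lt0r_neq0.
apply/negP; rewrite negbK -oppr_eq0; apply/eqP.
have := dot_sight_dual (straight_play x t) i i.
by rewrite eqxx mulr1n /sight ci subrr dotC dotr0 => <-.
Qed.

Lemma straight_play_end x : winning x ->
  (straight_play x (dE x)).1 = interception x /\
  forall i, row i (straight_play x (dE x)).2 = interception x.
Proof.
move=> wx; have [e r] := straight_play_shrunk (dE x) wx.
move: e r; rewrite divff ?gt_eqF ?dE_gt0 // subrr => -> r.
by split=> [|i]; rewrite ?r scale0r subr0.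
Qed.

Lemma straight_play_terminating x sE sP : winning x ->
  (forall t, 0 < t < dE x -> sE (straight_play x t) = uEstar x /\
                             sP (straight_play x t) = uPstar x) ->
  terminating_play sE sP x (dE x) (straight_play x).
Proof.
move=> wx H; split; first exact: dE_gt0.
- split; first by rewrite /straight_play scale0r addr0.
    exact/continuous_subspaceT/straight_play_continuous.
  by move=> t /H [-> ->]; exact: straight_play_derive.
- by move=> t; exact: straight_play_active.
- by have [e r] := straight_play_end wx; left; exists 0; rewrite e r.
Qed.

(** The straight play is generated both by the feedback maps [uEstar] and
    [uPstar], whose values are constant along it, and by the constant
    strategies of the same directions, which are admissible everywhere. *)
Lemma winning_optimal x : winning x ->
  optimal_from (@uEstar R) (@uPstar R) x (V x) (interception x).
Proof.
move=> wx; have [_ L0 _ _ _] := wx; have [e r] := straight_play_end wx.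
exists (dE x), (straight_play x); split => //.
  apply: straight_play_terminating => // t /andP[_ td].
  have sh := straight_play_shrunk t wx.
  have s0 : 0 < 1 - t / dE x by rewrite subr_gt0 ltr_pdivrMr ?mul1r // dE_gt0.
  by split; [exact: uEstar_shrunk sh|exact: uPstar_shrunk sh].
exists (cst (uEstar x)), (cst (uPstar x)); split.
- exact: secures_straight.
- by apply: strategyP_cst => i; exact: uPstar_norm.
- exact: straight_play_terminating.
- by rewrite e mxE.
Qed.

End OptimalPlay.

Theorem theorem2 (R : realType) :
  C1_on (@Rp R) (@V R) /\
  (forall x : state R, Rp x ->
     [/\ Lambda x != 0, 0 < dE x & forall i : 'I_3, 0 < dP x i] /\
     is_value x (V x) /\
     HJI (@V R) x (uEstar x) (uPstar x) /\
     HJI_optimal_controls (@V R) x (uEstar x) (uPstar x) /\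
     optimal_from (@uEstar R) (@uPstar R) x (V x) (interception x)).
Proof.
split; first by apply: C1_on_V => x /Rp_winning [].
move=> x /Rp_winning wx; have [_ L0 _ _ _] := wx.
split; first by split=> // [|i]; rewrite ?dPE // dE_gt0.
split; first exact: winning_value.
split; first exact: V_HJI.
split; first exact: V_HJI_saddle.
exact: winning_optimal.
Qed.
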